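(* (i) A convex p-to-e calibrator is a p*-to-e calibrator; and a convex admissible p-to-e calibrator is an admissible p*-to-e calibrator. (ii) An admissible p-to-e calibrator is a p*-to-e calibrator if and only if it is convex. (iii) The function $e\mapsto(2e)^{-1}\wedge1$ on $[0,\infty]$ is an e-to-p* calibrator, and it essentially dominates all other e-to-p* calibrators.
   Context: All random variables live on a fixed atomless probability space, assumed rich enough that for any given random vector there exists a random variable uniform on $[0,1]$ independent of it. ''Increasing'' and ''decreasing'' are in the non-strict sense. For random variables $X,Y$: $X\le_1 Y$ means $\mathbb E[f(X)]\le \mathbb E[f(Y)]$ for all increasing real functions $f$ such that the expectations exist; $X\le_2 Y$ means the same inequality for all increasing concave real functions $f$ such that the expectations exist. With $U$ uniform on $[0,1]$: $P$ is a p-variable if $U\le_1 P$ (equivalently $\mathbb P(P\le\alpha)\le\alpha$ for all $\alpha\in(0,1)$); $P$ is a p*-variable if $U\le_2 P$. An e-variable is a $[0,\infty]$-valued random variable $E$ with $\mathbb E[E]\le1$. A p-to-e (respectively p*-to-e) calibrator is a decreasing function $f:[0,1]\to[0,\infty]$ such that $f(P)$ is an e-variable for every p-variable (respectively p*-variable) $P$; input values larger than $1$ are treated as $1$. An e-to-p* calibrator is a decreasing function $g:[0,\infty]\to[0,1]$ such that $g(E)$ is a p*-variable for every e-variable $E$. For calibrators to e-values, $f$ dominates $g$ if $f\ge g$ pointwise, strictly if moreover $f\ne g$; such a calibrator is admissible if it is not strictly dominated by another calibrator of the same kind. An e-to-p* calibrator $f$ essentially dominates another e-to-p* calibrator $f'$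 if $f(e)\le f'(e)$ whenever $f'(e)<1/2$. Conventions: $1/0=\infty$, $1/\infty=0$. *)

(* Defs.v *)
From HB Require Import structures.
From mathcomp Require Export all_boot all_order all_algebra.
From mathcomp Require Export all_classical all_reals all_analysis.
From mathcomp Require Export measurable_realfun.

Set Implicit Arguments.
Unset Strict Implicit.
Unset Printing Implicit Defensive.

Import Order.TTheory GRing.Theory Num.Theory.

Local Open Scope classical_set_scope.
Local Open Scope ring_scope.
Local Open Scope ereal_scope.

Definition atomless (d : measure_display) (T : measurableType d) (R : realType)
    (P : probability T R) : Prop :=
  forall A : set T, measurable A -> 0 < P A ->
    exists B : set T, [/\ measurable B, B `<=` A, 0 < P B & P B < P A].

Definition independent_RV (d d1 d2 : measure_display) (T : measurableType d)
    (T1 : measurableType d1) (T2 : measurableType d2) (R : realType)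
    (P : probability T R) (X : {RV P >-> T1}) (Y : {RV P >-> T2}) : Prop :=
  forall (A : set T1) (B : set T2), measurable A -> measurable B ->
    P (X @^-1` A `&` Y @^-1` B) = P (X @^-1` A) * P (Y @^-1` B).

Definition uniform01 (d : measure_display) (T : measurableType d) (R : realType)
    (P : probability T R) (U : {RV P >-> R}) : Prop :=
  forall A : set R, measurable A ->
    distribution P U A = uniform_prob (@ltr01 R) A.

Definition rich (d : measure_display) (T : measurableType d) (R : realType)
    (P : probability T R) : Prop :=
  forall (n : nat) (X : {RV P >-> n.-tuple R}),
    exists U : {RV P >-> R}, uniform01 U /\ independent_RV X U.

(* The expectation is allowed to be infinite; only oo - oo is excluded. *)
Definition expectation_exists (d : measure_display) (T : measurableType d)
    (R : realType) (P : probability T R) (X : T -> R) : Prop :=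
  'E_P[(X^\+)%R] < +oo \/ 'E_P[(X^\-)%R] < +oo.

Definition concave_fun (R : realType) (f : R -> R) : Prop :=
  @convex_function R R^o [set: R^o] (fun x => - f x)%R.

Definition st_le1 (d : measure_display) (T : measurableType d) (R : realType)
    (P : probability T R) (X Y : T -> R) : Prop :=
  forall f : R -> R, {homo f : x y / (x <= y)%R} ->
    expectation_exists P (f \o X) -> expectation_exists P (f \o Y) ->
    'E_P[f \o X] <= 'E_P[f \o Y].

Definition st_le2 (d : measure_display) (T : measurableType d) (R : realType)
    (P : probability T R) (X Y : T -> R) : Prop :=
  forall f : R -> R, {homo f : x y / (x <= y)%R} -> concave_fun f ->
    expectation_exists P (f \o X) -> expectation_exists P (f \o Y) ->
    'E_P[f \o X] <= 'E_P[f \o Y].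

(* The two orders depend only on the laws of the variables, so the choice of
   the uniform variable U is immaterial. *)
Definition p_variable (d : measure_display) (T : measurableType d)
    (R : realType) (P : probability T R) (X : T -> R) : Prop :=
  measurable_fun [set: T] X /\
  exists U : {RV P >-> R}, uniform01 U /\ st_le1 P U X.

Definition pstar_variable (d : measure_display) (T : measurableType d)
    (R : realType) (P : probability T R) (X : T -> R) : Prop :=
  measurable_fun [set: T] X /\
  exists U : {RV P >-> R}, uniform01 U /\ st_le2 P U X.

Definition e_variable (d : measure_display) (T : measurableType d)
    (R : realType) (P : probability T R) (E : T -> \bar R) : Prop :=
  [/\ measurable_fun [set: T] E,
      forall w, 0 <= E w &
      \int[P]_w E w <= 1].

(* A function [0,1] -> [0,oo] is represented by f : R -> \bar R, of which only
   the restriction to [0,1] is ever used. *)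

(* Inputs larger than 1 are treated as 1. p- and p*-variables are nonnegative
   only almost surely; truncating at 0 gives f a value on the null event where
   they are negative. *)
Definition clamp01 (R : realType) (x : R) : R := Num.max 0%R (Num.min x 1%R).

(* V is the class of admitted inputs: p_variable P or pstar_variable P. *)
Definition to_e_calibrator (d : measure_display) (T : measurableType d)
    (R : realType) (P : probability T R) (V : (T -> R) -> Prop)
    (f : R -> \bar R) : Prop :=
  [/\ forall x : R, x \in `[0%R, 1%R] -> 0 <= f x,
      {in `[0%R, 1%R] &, forall x y, (x <= y)%R -> f y <= f x} &
      forall X, V X -> e_variable P (fun w => f (clamp01 (X w)))].

Definition p_to_e_calibrator (d : measure_display) (T : measurableType d)
    (R : realType) (P : probability T R) (f : R -> \bar R) : Prop :=
  to_e_calibrator P (p_variable P) f.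

Definition pstar_to_e_calibrator (d : measure_display) (T : measurableType d)
    (R : realType) (P : probability T R) (f : R -> \bar R) : Prop :=
  to_e_calibrator P (pstar_variable P) f.

Definition dominates01 (R : realType) (f g : R -> \bar R) : Prop :=
  forall x : R, x \in `[0%R, 1%R] -> g x <= f x.

Definition strictly_dominates01 (R : realType) (f g : R -> \bar R) : Prop :=
  dominates01 f g /\ exists2 x : R, x \in `[0%R, 1%R] & f x <> g x.

Definition admissible (R : realType) (C : (R -> \bar R) -> Prop)
    (f : R -> \bar R) : Prop :=
  C f /\ ~ exists2 g, C g & strictly_dominates01 g f.

(* With 0 * oo = 0 the inequality is trivial at t = 0 and t = 1, as it should
   be for functions that may take the value oo. *)
Definition convex01 (R : realType) (f : R -> \bar R) : Prop :=
  forall t x y : R,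
    t \in `[0%R, 1%R] -> x \in `[0%R, 1%R] -> y \in `[0%R, 1%R] ->
    f (t * x + (1 - t) * y)%R <= t%:E * f x + (1 - t)%:E * f y.

(* A function [0,oo] -> [0,1] is represented by g : \bar R -> R, of which only
   the restriction to [0,oo] is ever used. *)
Definition e_to_pstar_calibrator (d : measure_display) (T : measurableType d)
    (R : realType) (P : probability T R) (g : \bar R -> R) : Prop :=
  [/\ forall e, 0 <= e -> g e \in `[0%R, 1%R],
      forall e1 e2, 0 <= e1 -> e1 <= e2 -> (g e2 <= g e1)%R &
      forall E, e_variable P E -> pstar_variable P (g \o E)].

Definition essentially_dominates (R : realType) (g g' : \bar R -> R) : Prop :=
  forall e, 0 <= e -> (g' e < 1 / 2)%R -> (g e <= g' e)%R.

(* The library's inverse on \bar R satisfies 0^-1 = +oo and +oo^-1 = 0. *)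
Definition half_inv (R : realType) (e : \bar R) : R :=
  fine (mine (2%:E * e)^-1 1).

(* Main.v *)
(* Calibrators to e-values are tested on one uniform variable U in (0, 1).

   (i) A convex decreasing f agrees at each x > 0 with its decreasing n-Lipschitz
   minorants f_n for large n. These are convex, so E f_n(X) <= E f_n(U) <= 1 for
   every p*-variable X, and Fatou's lemma gives E f(X) <= 1.

   (ii) Admissibility forces f(0) = oo, f(1) = f(1-) and E f(U) = 1. For a < b,
   t < t' and small e, replacing U by m = t a + (1 - t) b on
   {U in ]a, a + t' e]} and {U in ]b, b + (1 - t') e]} gives a p*-variable, and
   comparing expectations yields f(m) <= t' f(a) + (1 - t') f(b). Let t' -> t.

   (iii) If k is convex decreasing with k(1) = 0, then 2 x k(x) <= E k(U), so
   k((2e)^-1 /\ 1) <= e E k(U) for all e. Conversely, the e-variable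
   r 1_{U <= 1/r} and the test function (1/r - x)^+ force g(r) >= 1 / (2r). *)
From HB Require Import structures.
Require Import Defs.
From mathcomp Require Import lra ring.
Import Order.TTheory GRing.Theory Num.Theory numFieldNormedType.Exports.

(** * Uniform variables *)

Section uniform.
Set Implicit Arguments.
Unset Strict Implicit.
Local Open Scope classical_set_scope.
Local Open Scope ring_scope.
Local Open Scope ereal_scope.
Context d (T : measurableType d) (R : realType) (P : probability T R).
Implicit Types (U V : {RV P >-> R}).

Lemma uniform01E U (A : set R) : uniform01 U -> measurable A ->
  P (U @^-1` A) = uniform_prob (@ltr01 R) A.
Proof. by move=> uU mA; exact: uU. Qed.

Lemma uniform01_itv U (a b : R) : uniform01 U ->
  (0 <= a)%R -> (a <= b)%R -> (b <= 1)%R ->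
  P (U @^-1` `]a, b]) = (b - a)%:E.
Proof.
move=> uU a0 ab b1.
rewrite uniform01E//.
rewrite /uniform_prob integral_uniform_pdf setIidl; last first.
  move=> x /=; rewrite !in_itv/= => /andP[ax xb].
  by rewrite (le_trans a0 (ltW ax)) (le_trans xb b1).
rewrite (eq_integral (cst 1)).
  rewrite integral_cst//= mul1e lebesgue_measure_itv/= lte_fin.
  by move: ab; rewrite le_eqVlt => /predU1P[->|ab]; rewrite ?ltxx ?subrr// ab EFinB.
move=> x; rewrite inE/= in_itv/= /uniform_pdf => /andP[ax xb].
by rewrite (le_trans a0 (ltW ax)) (le_trans xb b1) subr0 invr1.
Qed.

Lemma uniform01_integral_eq U V (h : R -> \bar R) : uniform01 U -> uniform01 V ->
  measurable_fun setT h -> (forall x, 0 <= h x) ->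
  \int[P]_w h (U w) = \int[P]_w h (V w).
Proof.
move=> uU uV mh h0.
rewrite -[LHS](ge0_integral_distribution U)// -[RHS](ge0_integral_distribution V)//.
by apply: eq_measure_integral => A mA _; rewrite [LHS]uU// [RHS]uV.
Qed.

(** Richness, applied to the empty tuple, provides a uniform variable. Resetting it to [1 / 2] on
    the null event where it leaves []0, 1[] keeps the law and makes the bounds hold at every
    point. *)
Lemma uniform01_exists : rich P ->
  exists2 U : {RV P >-> R}, uniform01 U & forall w, (0 < U w < 1)%R.
Proof.
move=> /(_ 0%N (cst [tuple])) [U [uU _]].
pose V w := if (0 < U w < 1)%R then U w else (1 / 2)%R.
have mB : measurable [set w | (0 < U w < 1)%R].
  have -> : [set w | (0 < U w < 1)%R] = U @^-1` `]0%R, 1%R[.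
    by apply/seteqP; split => w; rewrite /= in_itv.
  exact: measurable_funPTI.
have mV : measurable_fun setT V.
  apply: measurable_fun_ifT => //.
  apply: (measurable_fun_bool true).
  by rewrite setTI; exact: mB.
pose V' : {RV P >-> R} := HB.pack V (isMeasurableFun.Build _ _ _ _ _ mV).
exists V'; last first.
  by move=> w /=; rewrite /V; case: ifPn => // _; lra.
have P1 : P (U @^-1` [set 1%R]) = 0.
  rewrite uniform01E//.
  rewrite /uniform_prob; apply: null_set_integral => //.
    by apply/measurable_EFinP/measurable_funTS; exact: measurable_uniform_pdf.
  exact: lebesgue_measure_set1.
have P2 : P (~` (U @^-1` `]0%R, 1%R])) = 0.
  rewrite probability_setC; last exact: measurable_funPTI.
  by rewrite uniform01_itv// subr0 subee.
have PB : P (~` [set w | (0 < U w < 1)%R]) = 0.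
  have sB : ~` [set w | (0 < U w < 1)%R] `<=` ~` (U @^-1` `]0%R, 1%R]) `|` U @^-1` [set 1%R].
    move=> w /= B; have [U1|U1] := eqVneq (U w) 1%R; first by right.
    left; rewrite /= in_itv/= le_eqVlt (negbTE U1)/=; exact: B.
  have m1 : measurable (U @^-1` [set 1%R]) by exact: measurable_funPTI.
  have m2 : measurable (~` (U @^-1` `]0%R, 1%R])).
    by apply: measurableC; exact: measurable_funPTI.
  apply: (subset_measure0 _ _ sB).
  - exact: measurableC.
  - exact: measurableU.
  - exact: (etrans (measureU0 m2 m1 P1) P2).
move=> A mA; rewrite -(uU A mA) /distribution /pushforward/=.
have mVA : measurable (V @^-1` A) by exact: (@measurable_funPTI _ _ _ _ V').
have mUA : measurable (U @^-1` A) by exact: measurable_funPTI.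
(* The two preimages of [A] coincide on the event [0 < U < 1] and are null off it. *)
rewrite (measureDI P mVA mB) [RHS](measureDI P mUA mB).
congr (_ + _); last first.
  by congr (P _); apply/seteqP; split => w /=; rewrite /V => -[+ B]; rewrite B.
have D0 (C : set T) : measurable C -> P (C `\` [set w | (0 < U w < 1)%R]) = 0.
  move=> mC; apply: (subset_measure0 _ _ (@subIsetr _ C _)) => //.
  - exact: measurableD.
  - exact: measurableC.
by apply: (etrans (D0 _ mVA)); apply/esym; apply: (etrans (D0 _ mUA)).
Qed.

(** The area of a triangle; it is the uniform side of every comparison made with the test function
    [(a - x)^+]. *)
Lemma uniform01_excess U (a : R) : uniform01 U -> (0 < a)%R -> (a <= 1)%R ->
  \int[P]_w (Num.max (a - U w) 0)%:E = (a ^+ 2 / 2)%:E.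
Proof.
move=> uU a0 a1.
pose h (x : R) := (Num.max (a - x) 0)%:E.
have mh : measurable_fun setT h.
  apply/measurable_EFinP; apply: measurable_maxr => //.
  exact: measurable_funB.
have h0 x : 0 <= h x by rewrite lee_fin le_max lexx orbT.
(* uniform_prob is a measure on measurableTypeR R, which has the same sets as R
   but another display, so U is repackaged with that codomain. *)
have mU : measurable_fun setT (U : T -> measurableTypeR R) by exact: (@measurable_funP _ _ _ _ _ U).
pose U' : {RV P >-> measurableTypeR R} :=
  HB.pack (U : T -> measurableTypeR R) (isMeasurableFun.Build _ _ _ _ _ mU).
transitivity (\int[distribution P U']_x h x); first by rewrite ge0_integral_distribution.
transitivity (\int[uniform_prob (@ltr01 R)]_x h x).
  by apply: eq_measure_integral => A mA _; exact: uU.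
rewrite integral_uniform// subr0 invr1 mul1e.
have -> : \int[lebesgue_measure]_(x in `[0%R, 1%R]) h x = \int[lebesgue_measure]_(x in `[0%R, a]) (a - x)%:E.
  rewrite [LHS]integral_mkcond [RHS]integral_mkcond; apply: eq_integral => x _.
  rewrite !patchE !mem_setE /h !in_itv/=.
  case: (lerP 0 x) => //= x0; case: (lerP x a) => xa /=.
    by rewrite (le_trans xa a1) max_l// subr_ge0.
  by case: ifP => // _; rewrite max_r// subr_le0 ltW.
pose G (x : R) := (a * x - x ^+ 2 / 2)%R.
have dG (x : R) : is_derive x 1%R G (a - x)%R.
  rewrite /G; apply: is_derive_eq; rewrite /GRing.scale/=; lra.
rewrite (@continuous_FTC2 _ _ G)//.
- by rewrite /G -EFinB; congr EFin; lra.
- apply: continuous_subspaceT => x; apply: cvgB => //; exact: cvg_cst.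
- split.
  + by move=> x _; have [] := dG x.
  + apply: cvg_at_right_filter; apply: differentiable_continuous.
    by apply/derivable1_diffP; have [] := dG 0%R.
  + apply: cvg_at_left_filter; apply: differentiable_continuous.
    by apply/derivable1_diffP; have [] := dG a.
- by move=> x _; rewrite derive1E; have [_ ->] := dG x.
Qed.

End uniform.

(** * Convex functions *)

Section convex_analysis.
Set Implicit Arguments.
Unset Strict Implicit.
Local Open Scope classical_set_scope.
Local Open Scope ring_scope.
Context (R : realType).

Definition convex_real (h : R -> R) := forall t x y : R, (0 <= t <= 1) ->
  (h (t * x + (1 - t) * y) <= t * h x + (1 - t) * h y).

Lemma concave_funP (h : R -> R) :
  concave_fun h <-> convex_real (fun x => - h x).
Proof.
split=> [ch t x y /andP[t0 t1]|ch t x y _ _].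
  have := ch (Itv01 t0 t1) x y (in_setT _) (in_setT _).
  by rewrite !convRE/=.
have t01 : (0 <= t%:num <= 1) by rewrite ge0 le1.
by have := ch t%:num x y t01; rewrite !convRE.
Qed.

Lemma convex_real_three_points (h : R -> R) (y m z : R) : convex_real h -> y < m -> m < z ->
  (z - y) * h m <= (z - m) * h y + (m - y) * h z.
Proof.
move=> ch ym mz; have zy : 0 < z - y by lra.
have t01 : 0 <= (z - m) / (z - y) <= 1.
  by rewrite divr_ge0/= ?ler_pdivrMr; lra.
have := ch _ y z t01.
have -> : (z - m) / (z - y) * y + (1 - (z - m) / (z - y)) * z = m by field; lra.
rewrite -(ler_pM2l zy) => /le_trans; apply; rewrite le_eqVlt; apply/orP; left; apply/eqP.
by field; lra.
Qed.

(** The slope is the supremum of the difference quotients to the left of [m]; each quotient to the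
    right of [m] bounds them all. *)
Lemma convex_real_support (h : R -> R) (m : R) : convex_real h ->
  exists s : R, forall x, h m + s * (x - m) <= h x.
Proof.
move=> ch; pose S := [set (h m - h y) / (m - y) | y in [set y | y < m]].
have ubS z : m < z -> ubound S ((h z - h m) / (z - m)).
  move=> mz _ [y /= ym <-].
  rewrite ler_pdivrMr; last lra.
  rewrite mulrAC ler_pdivlMr; last lra.
  by have := convex_real_three_points ch ym mz; lra.
have S0 : S !=set0 by exists ((h m - h (m - 1)) / (m - (m - 1))), (m - 1) => //=; lra.
have hS : has_sup S by split => //; exists ((h (m + 1) - h m) / (m + 1 - m)); apply: ubS; lra.
exists (sup S) => x; have [xm|mx|->] := ltgtP x m; last by lra.
- have : (h m - h x) / (m - x) <= sup S by apply: ub_le_sup; [exact: hS.2|exists x].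
  by rewrite ler_pdivrMr; lra.
- have : sup S <= (h x - h m) / (x - m) by apply: ge_sup => //; exact: ubS.
  by rewrite ler_pdivlMr; lra.
Qed.

(** * Decreasing Lipschitz minorants *)

Section lipschitz_hull.
Variables (f : R -> R) (n : nat).
Hypothesis f_ge0 : forall y, 0 < y <= 1 -> 0 <= f y.

(** Inf-convolution of [f] with the one-sided kernel [n * u^+], which makes the result decreasing
    and [n]-Lipschitz on the whole line. The point 0 is left out of the infimum because a calibrator
    may be infinite there. *)
Definition lip_hull (x : R) : R :=
  inf [set f y + n%:R * Num.max (y - x) 0 | y in [set y | 0 < y <= 1]].

Let lb0 x : lbound [set f y + n%:R * Num.max (y - x) 0 | y in [set y | 0 < y <= 1]] 0.
Proof.
by move=> _ [y /= y01 <-]; rewrite addr_ge0 ?f_ge0// mulr_ge0// le_max lexx orbT.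
Qed.

Let ne x : [set f y + n%:R * Num.max (y - x) 0 | y in [set y | 0 < y <= 1]] !=set0.
Proof. by exists (f 1 + n%:R * Num.max (1 - x) 0), 1 => //=; rewrite ltr01 lexx. Qed.

Lemma lip_hull_ge0 x : 0 <= lip_hull x.
Proof. exact: lb_le_inf. Qed.

Lemma lip_hull_le x y : 0 < y <= 1 -> lip_hull x <= f y + n%:R * Num.max (y - x) 0.
Proof. by move=> y01; apply: ge_inf; [exists 0|exists y]. Qed.

Lemma lip_hull_le_self x : 0 < x <= 1 -> lip_hull x <= f x.
Proof. by move=> x01; rewrite (le_trans (lip_hull_le x x01))// subrr maxxx mulr0 addr0. Qed.

Lemma lip_hull_nonincreasing : {homo lip_hull : x y / x <= y >-> y <= x}.
Proof.
move=> x x' xx'; apply: lb_le_inf => // _ [y /= y01 <-].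
apply: (le_trans (lip_hull_le x' y01)); rewrite lerD2l ler_wpM2l//.
by rewrite ge_max !le_max lexx orbT andbT lerD2l lerN2 xx'.
Qed.

(** The convex combination of near-minimisers at [x] and [x'] competes in the infimum at the
    combined point, and the kernel is itself convex. *)
Lemma lip_hull_convex :
  (forall t y z, 0 <= t <= 1 -> 0 < y <= 1 -> 0 < z <= 1 ->
     f (t * y + (1 - t) * z) <= t * f y + (1 - t) * f z) ->
  convex_real lip_hull.
Proof.
move=> cf t x x' t01; apply/ler_addgt0Pr => e e0.
have adh u : exists2 y, 0 < y <= 1 & f y + n%:R * Num.max (y - u) 0 < lip_hull u + e.
  have hi : has_inf [set f y + n%:R * Num.max (y - u) 0 | y in [set y | 0 < y <= 1]].
    by split; [exact: ne|exists 0; exact: lb0].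
  by have [_ [y /= y01 <-] yu] := inf_adherent e0 hi; exists y.
have [y y01 yx] := adh x; have [z z01 zx] := adh x'.
have yz01 : 0 < t * y + (1 - t) * z <= 1 by nra.
apply: (le_trans (lip_hull_le _ yz01)).
have cfyz := cf t y z t01 y01 z01.
have M : Num.max (t * y + (1 - t) * z - (t * x + (1 - t) * x')) 0 <=
    t * Num.max (y - x) 0 + (1 - t) * Num.max (z - x') 0.
  have m1 : y - x <= Num.max (y - x) 0 by rewrite le_max lexx.
  have m2 : z - x' <= Num.max (z - x') 0 by rewrite le_max lexx.
  have m3 : 0 <= Num.max (y - x) 0 by rewrite le_max lexx orbT.
  have m4 : 0 <= Num.max (z - x') 0 by rewrite le_max lexx orbT.
  have /andP[t0 t1] := t01; have t1' : 0 <= 1 - t by lra.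
  rewrite ge_max addr_ge0 ?mulr_ge0// andbT.
  by have := ler_wpM2l t0 m1; have := ler_wpM2l t1' m2; lra.
have nM := ler_wpM2l (ler0n R n) M.
have /andP[t0 t1] := t01; have t1' : 0 <= 1 - t by lra.
by have := ler_wpM2l t0 (ltW yx); have := ler_wpM2l t1' (ltW zx); lra.
Qed.

End lipschitz_hull.

(** By monotonicity no [y <= min x 1] gives less than [f (min x 1)]. For [x < 1], no [y > x] does so
    once [n] reaches the steepness of a chord to the left of [x], since a convex function only
    flattens further right. *)
Lemma lip_hull_eventually (f : R -> R) (x : R) :
  (forall y, 0 < y <= 1 -> 0 <= f y) ->
  (forall y z, 0 < y -> y <= z -> z <= 1 -> f z <= f y) ->
  (forall t y z, 0 <= t <= 1 -> 0 < y <= 1 -> 0 < z <= 1 ->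
     f (t * y + (1 - t) * z) <= t * f y + (1 - t) * f z) ->
  0 < x -> \forall n \near \oo, lip_hull f n x = f (Num.min x 1).
Proof.
move=> f0 f_ni cf x0.
near=> n; apply/eqP; rewrite eq_le; apply/andP; split.
  have m01 : 0 < Num.min x 1 <= 1 by rewrite lt_min x0 ltr01 ge_min lexx orbT.
  rewrite (le_trans (lip_hull_le n f0 x m01))//.
  by rewrite (_ : Num.max _ 0 = 0) ?mulr0 ?addr0//; apply/max_idPr; rewrite subr_le0 ge_min lexx.
apply: lb_le_inf.
  by exists (f 1 + n%:R * Num.max (1 - x) 0), 1 => //=; rewrite ltr01 lexx.
move=> _ [y /= /andP[y0 y1] <-].
have [yx|xy] := leP y (Num.min x 1).
  rewrite (le_trans (f_ni _ _ y0 yx _))//; first by rewrite ge_min lexx orbT.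
  by rewrite lerDl mulr_ge0// le_max lexx orbT.
have x1 : x < 1.
  by rewrite ltNge; apply/negP => x1; move: xy; rewrite min_r// ltNge y1.
move: xy; rewrite min_l ?(ltW x1)// => xy.
rewrite max_l; last lra.
(* The left side is the steepness of the chord of [f] over [[x / 2, x]]. *)
have nx : 2 * (f (x / 2) - f x) / x <= n%:R by near: n; exact: nbhs_infty_ger.
have yx0 : 0 < y - x / 2 by lra.
have t01 : 0 <= (y - x) / (y - x / 2) <= 1.
  by rewrite divr_ge0/= ?ler_pdivrMr; lra.
have := cf _ (x / 2) y t01.
have -> : (y - x) / (y - x / 2) * (x / 2) + (1 - (y - x) / (y - x / 2)) * y = x.
  by field; lra.
move=> /(_ ltac:(lra) ltac:(lra)).
rewrite -(ler_pM2l yx0).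
have -> : (y - x / 2) * ((y - x) / (y - x / 2) * f (x / 2) + (1 - (y - x) / (y - x / 2)) * f y) =
  (y - x) * f (x / 2) + x / 2 * f y by field; lra.
move=> H; move: nx; rewrite ler_pdivrMr// => nx.
have H2 : (y - x) * (2 * (f (x / 2) - f x)) <= (y - x) * (n%:R * x).
  by rewrite ler_wpM2l//; lra.
rewrite -(ler_pM2l x0) mulrDr; move: H H2; set N : R := n%:R; nra.
Unshelve. all: by end_near. Qed.

End convex_analysis.

(** * Stochastic orders *)

Section orders.
Set Implicit Arguments.
Unset Strict Implicit.
Local Open Scope classical_set_scope.
Local Open Scope ring_scope.
Local Open Scope ereal_scope.
Context d (T : measurableType d) (R : realType) (P : probability T R).
Implicit Types (U V : {RV P >-> R}) (X Y : T -> R).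

(** Monotonicity makes the preimages of upper rays intervals. *)
Lemma nonincreasing_emeasurable (F : R -> \bar R) :
  {homo F : x y / (x <= y)%R >-> y <= x} -> measurable_fun [set: R] F.
Proof.
move=> F_ni; apply: (measurability (@ErealGenCInfty.G R)) => [|/= _ [_] [r] -> <-].
  exact: ErealGenCInfty.measurableE.
rewrite setTI; apply: is_interval_measurable => s t/=.
rewrite !in_itv/= !andbT => fs ft u /andP[su ut].
by rewrite in_itv/= andbT (le_trans ft)// F_ni.
Qed.

(** Fatou's lemma: [G] is almost everywhere the lower limit of the [g n], and the integral of that
    limit is at most the lower limit of the integrals. *)
Lemma integral_le_of_cvg (g : nat -> T -> \bar R) (G : T -> \bar R) (c : \bar R) :
  (forall n, measurable_fun setT (g n)) -> (forall n w, 0 <= g n w) ->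
  measurable_fun setT G -> (forall w, 0 <= G w) ->
  {ae P, forall w, g n w @[n --> \oo] --> G w} ->
  (forall n, \int[P]_w g n w <= c) -> \int[P]_w G w <= c.
Proof.
move=> mg g0 mG G0 gG gc.
have mlim : measurable_fun setT (fun w => limn_einf (g ^~ w)).
  apply: (eq_measurable_fun (fun w => - limn_esup (fun n => - g n w))).
    by move=> w _; rewrite -[RHS]oppeK -limn_esupN.
  apply: measurableT_comp => //; apply: measurable_fun_limn_esup => n.
  exact: measurableT_comp.
have lim0 w : 0 <= limn_einf (g ^~ w).
  rewrite limn_einf_lim; apply: lime_ge; first exact: is_cvg_einfs.
  by apply: nearW => n; apply: le_ereal_inf_tmp => _ [m /= _ <-].
apply: (@le_trans _ _ (\int[P]_w limn_einf (g ^~ w))).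
  apply: ae_ge0_le_integral => //.
  apply: filterS gG => w gG _.
  by have [-> _] := cvg_limn_einf_sup gG.
apply: (le_trans (fatou _ _ _ _)) => //.
rewrite limn_einf_lim; apply: lime_le; first exact: is_cvg_einfs.
apply: nearW => n; apply: le_trans (gc n).
by apply: ereal_inf_lbound; exists n => /=.
Qed.

Lemma st_le1W X Y : st_le1 P X Y -> st_le2 P X Y.
Proof. by move=> XY f f_nd _; exact: XY. Qed.

Lemma pstar_variableW X : p_variable P X -> pstar_variable P X.
Proof. by move=> [mX [U [uU UX]]]; split => //; exists U; split => //; exact: st_le1W. Qed.

Lemma uniform01_p_variable U : uniform01 U -> p_variable P U.
Proof. by move=> uU; split => //; exists U; split. Qed.

Lemma expectation_oppr_ge0 X : (forall w, 0 <= X w)%R ->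
  'E_P[fun w => - X w]%R = - \int[P]_w (X w)%:E.
Proof.
move=> X0; rewrite unlock -integral_ge0N//=.
by move=> w _; rewrite lee_fin.
Qed.

Lemma expectation_exists_oppr X : (forall w, 0 <= X w)%R ->
  expectation_exists P (fun w => - X w)%R.
Proof.
move=> X0; left; rewrite unlock integral0_eq ?ltry// => w _ /=.
by rewrite /funrpos max_r// oppr_le0.
Qed.

Lemma st_le1_integral X Y (h : R -> R) : st_le1 P X Y ->
  {homo h : x y / (x <= y)%R >-> (y <= x)%R} -> (forall x, 0 <= h x)%R ->
  \int[P]_w (h (Y w))%:E <= \int[P]_w (h (X w))%:E.
Proof.
move=> XY h_ni h0; rewrite -leeN2 -!expectation_oppr_ge0//.
apply: (XY (fun x => - h x)%R); try exact: expectation_exists_oppr.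
by move=> x y xy; rewrite lerN2; exact: h_ni.
Qed.

Lemma st_le2_integral X Y (h : R -> R) : st_le2 P X Y ->
  {homo h : x y / (x <= y)%R >-> (y <= x)%R} -> convex_real h -> (forall x, 0 <= h x)%R ->
  \int[P]_w (h (Y w))%:E <= \int[P]_w (h (X w))%:E.
Proof.
move=> XY h_ni ch h0; rewrite -leeN2 -!expectation_oppr_ge0//.
apply: (XY (fun x => - h x)%R); try exact: expectation_exists_oppr.
  by move=> x y xy; rewrite lerN2; exact: h_ni.
by apply/concave_funP => t x y t01; rewrite !opprK; exact: ch.
Qed.

Lemma cvg_mine_nat (x : \bar R) : 0 <= x ->
  (mine x n%:R%:E : \bar R) @[n --> \oo] --> x.
Proof.
case: x => [r| |//] r0.
  apply: (cvg_near_cst r%:E).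
  near=> n; apply/min_idPl; rewrite lee_fin.
  by near: n; exact: nbhs_infty_ger.
under eq_cvg do rewrite minye.
exact/cvgenyP.
Unshelve. all: by end_near. Qed.

(** The order tests only real-valued functions, so [F] is truncated at [n] and Fatou's lemma removes
    the truncation. *)
Lemma p_variable_integral_le X U (F : R -> \bar R) :
  p_variable P X -> uniform01 U ->
  {homo F : x y / (x <= y)%R >-> y <= x} -> (forall x, 0 <= F x) ->
  \int[P]_w F (X w) <= \int[P]_w F (U w).
Proof.
move=> [mX [V [uV VX]]] uU F_ni F0.
pose h n x := fine (mine (F x) n%:R%:E).
have hE n x : (h n x)%:E = mine (F x) n%:R%:E.
  rewrite fineK// ge0_fin_numE; last by rewrite le_min F0 lee_fin ler0n.
  by rewrite gt_min ltry orbT.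
have h_ni n : {homo h n : x y / (x <= y)%R >-> (y <= x)%R}.
  by move=> x y xy; rewrite -lee_fin !hE le_min !ge_min lexx orbT andbT F_ni.
have h0 n x : (0 <= h n x)%R by rewrite -lee_fin hE le_min F0 lee_fin ler0n.
have mh n : measurable_fun setT (h n) by exact: nonincreasing_measurable.
have mF := nonincreasing_emeasurable F_ni.
apply: (@integral_le_of_cvg (fun n w => (h n (X w))%:E)) => //.
- by move=> n; apply/measurable_EFinP; exact: measurableT_comp.
- by move=> n w; rewrite lee_fin.
- exact: measurableT_comp.
- apply: aeW => w; under eq_cvg do rewrite hE.
  exact: cvg_mine_nat.
move=> n; apply: le_trans; first exact: (st_le1_integral VX (h_ni n) (h0 n)).
(* The uniform variable [V] that comes with [X] is exchanged for [U], which has the same law. *)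
rewrite (uniform01_integral_eq (h := EFin \o h n) uV uU)//=; last 2 first.
- exact/measurable_EFinP.
- by move=> x; rewrite lee_fin.
apply: ge0_le_integral => //.
- by move=> w _; rewrite lee_fin.
- by apply/measurable_EFinP; exact: measurableT_comp.
- exact: measurableT_comp.
- by move=> w _; rewrite hE ge_min lexx.
Qed.

End orders.

(** * Calibrators *)

Section calibrators.
Set Implicit Arguments.
Unset Strict Implicit.
Local Open Scope classical_set_scope.
Local Open Scope ring_scope.
Local Open Scope ereal_scope.
Context d (T : measurableType d) (R : realType) (P : probability T R).
Implicit Types (U V : {RV P >-> R}) (X Y : T -> R) (f g : R -> \bar R).

(** * Testing p-to-e calibrators on one uniform variable *)

Lemma clamp01_itv (x : R) : clamp01 x \in `[0%R, 1%R].
Proof. by rewrite in_itv/= /clamp01 le_max lexx ge_max ler01 ge_min lexx orbT. Qed.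

Lemma clamp01_id (x : R) : (0 <= x <= 1)%R -> clamp01 x = x.
Proof. by move=> /andP[x0 x1]; rewrite /clamp01 min_l// max_r. Qed.

Lemma le_clamp01 : {homo @clamp01 R : x y / (x <= y)%R}.
Proof. by move=> x y xy; apply: le_max2 => //; exact: le_min2. Qed.

Lemma clamp01_comp_nonincreasing f :
  {in `[0%R, 1%R] &, forall x y, (x <= y)%R -> f y <= f x} ->
  {homo f \o @clamp01 R : x y / (x <= y)%R >-> y <= x}.
Proof. by move=> f_ni x y xy; apply: f_ni; rewrite ?clamp01_itv ?le_clamp01. Qed.

Lemma p_to_e_calibratorP U f : uniform01 U ->
  (forall x : R, x \in `[0%R, 1%R] -> 0 <= f x) ->
  {in `[0%R, 1%R] &, forall x y, (x <= y)%R -> f y <= f x} ->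
  \int[P]_w f (clamp01 (U w)) <= 1 -> p_to_e_calibrator P f.
Proof.
move=> uU f0 f_ni fU; split => // X pX.
have F_ni := clamp01_comp_nonincreasing f_ni.
have F0 x : 0 <= (f \o @clamp01 R) x by apply: f0; exact: clamp01_itv.
split => //.
- apply: (measurableT_comp (nonincreasing_emeasurable F_ni)).
  by have [] := pX.
- by move=> w; exact: F0.
- exact: (le_trans (p_variable_integral_le pX uU F_ni F0) fU).
Qed.

Lemma calibrator_integral_le1 U f : uniform01 U -> p_to_e_calibrator P f ->
  \int[P]_w f (clamp01 (U w)) <= 1.
Proof. by move=> uU [_ _ /(_ U)][]//; exact: uniform01_p_variable. Qed.

(** An infinite value at [x] would spread to all of []0, x]], where [U] lies with probability
    [x > 0], and the mean would be infinite. *)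
Lemma calibrator_fin_num U f (x : R) : uniform01 U -> p_to_e_calibrator P f ->
  (0 < x <= 1)%R -> f x \is a fin_num.
Proof.
move=> uU cf /andP[x0 x1]; have [f0 f_ni _] := cf.
have x01 : x \in `[0%R, 1%R] by rewrite in_itv/= ltW.
rewrite ge0_fin_numE ?f0// ltey; apply/eqP => fx.
have := calibrator_integral_le1 uU cf; apply/negP; rewrite -ltNge.
have mU : measurable (U @^-1` `]0%R, x]) by exact: measurable_funPTI.
have mf : measurable_fun setT (fun w => f (clamp01 (U w))).
  apply: (measurableT_comp (nonincreasing_emeasurable (clamp01_comp_nonincreasing f_ni))).
  exact: measurable_funP.
apply: (@lt_le_trans _ _ (\int[P]_(w in U @^-1` `]0%R, x]) f (clamp01 (U w)))); last first.
  apply: ge0_subset_integral => //.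
  by move=> w _; apply: f0; exact: clamp01_itv.
rewrite (eq_integral (cst +oo)); last first.
  move=> w; rewrite inE/= in_itv/= => /andP[Uw0 Uwx].
  apply/eqP; rewrite -leye_eq -fx f_ni ?clamp01_itv//.
  by rewrite clamp01_id// (ltW Uw0) (le_trans Uwx).
rewrite integral_cst// [X in _ * X](uniform01_itv uU (lexx _) (ltW x0) x1) subr0.
by rewrite gt0_mulye ?ltry// lte_fin.
Qed.

(** * Consequences of the p*-property, and part (i) *)

Lemma measurable_le0 X : measurable_fun setT X -> measurable [set w | (X w <= 0)%R].
Proof.
move=> mX; rewrite (_ : [set _ | _] = setT `&` X @^-1` `]-oo, 0%R]); first exact: mX.
by apply/seteqP; split => w; rewrite /= in_itv//= => -[].
Qed.

(** [(a - x)^+] is convex and decreasing. The bound serves twice: for the almost sure positivity of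
    p*-variables and for the optimality of [half_inv]. *)
Lemma pstar_variable_excess X (a : R) : pstar_variable P X -> (0 < a)%R -> (a <= 1)%R ->
  \int[P]_w (Num.max (a - X w) 0)%:E <= (a ^+ 2 / 2)%:E.
Proof.
move=> [mX [U [uU UX]]] a0 a1; rewrite -(uniform01_excess uU a0 a1).
pose h (x : R) := Num.max (a - x)%R 0%R.
apply: (st_le2_integral UX (h := h)).
- by move=> x y xy; apply: le_max2; rewrite ?lerD2l ?lerN2.
- move=> t x y /andP[t0 t1]; have t1' : (0 <= 1 - t)%R by lra.
  have h0 z : (0 <= h z)%R by rewrite le_max lexx orbT.
  rewrite {1}/h ge_max addr_ge0 ?mulr_ge0// andbT.
  have hx : (a - x <= h x)%R by rewrite le_max lexx.
  have hy : (a - y <= h y)%R by rewrite le_max lexx.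
  by have := ler_wpM2l t0 hx; have := ler_wpM2l t1' hy; lra.
- by move=> x; rewrite le_max lexx orbT.
Qed.

(* The test function (a - x)^+ gives P(X <= 0) <= a / 2 for every a in (0, 1]. *)
Lemma pstar_variable_gt0 X : pstar_variable P X -> P [set w | (X w <= 0)%R] = 0.
Proof.
move=> pX; have [mX _] := pX.
have mX0 := measurable_le0 mX.
have PX a : (0 < a)%R -> (a <= 1)%R -> P [set w | (X w <= 0)%R] <= (a / 2)%:E.
  move=> a0 a1; pose h (x : R) := Num.max (a - x)%R 0%R.
  have h_ni : {homo h : x y / (x <= y)%R >-> (y <= x)%R}.
    by move=> x y xy; apply: le_max2; rewrite ?lerD2l ?lerN2.
  have h0 x : (0 <= h x)%R by rewrite le_max lexx orbT.
  have hX := pstar_variable_excess pX a0 a1.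
  have aX : a%:E * P [set w | (X w <= 0)%R] <= \int[P]_w (h (X w))%:E.
    rewrite -[leLHS]integral_cst//=.
    apply: (@le_trans _ _ (\int[P]_(w in [set w | (X w <= 0)%R]) (h (X w))%:E)).
      apply: ge0_le_integral => //.
      - by move=> w _; rewrite lee_fin ltW.
      - apply/measurable_EFinP/measurable_funTS/measurableT_comp => //.
        exact: nonincreasing_measurable.
      - by move=> w /= Xw; rewrite lee_fin le_max; apply/orP; left; lra.
    apply: ge0_subset_integral => //.
    - apply/measurable_EFinP/measurableT_comp => //.
      exact: nonincreasing_measurable.
    - by move=> w _; rewrite lee_fin.
  have := le_trans aX hX.
  by rewrite expr2 -mulrA EFinM lee_pmul2l.
apply/eqP; rewrite eq_le measure_ge0 andbT.
apply/lee_addgt0Pr => e e0; rewrite add0e.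
have m0 : (0 < Num.min e 1)%R by rewrite lt_min e0 ltr01.
have m1 : (Num.min e 1 <= 1)%R by rewrite ge_min lexx orbT.
have me : (Num.min e 1 <= e)%R by rewrite ge_min lexx.
apply: (le_trans (PX _ m0 m1)); rewrite lee_fin; lra.
Qed.

Lemma convex01_pstar_calibrator f : rich P ->
  convex01 f -> p_to_e_calibrator P f -> pstar_to_e_calibrator P f.
Proof.
move=> hrich cf pf; have [f0 f_ni _] := pf; split => // X pX.
have [U uU U01] := uniform01_exists hrich.
have F_ni := clamp01_comp_nonincreasing f_ni.
have mF := nonincreasing_emeasurable F_ni.
have [mX [V [uV VX]]] := pX.
have mFX : measurable_fun setT (fun w => f (clamp01 (X w))).
  exact: (measurableT_comp mF).
split => //; first by move=> w; apply: f0; exact: clamp01_itv.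
(* [fr] agrees with [f] on []0, 1]]. It loses a possibly infinite value at 0, which is harmless
   because [X] is almost surely positive. *)
pose fr x := fine (f x).
have frE x : (0 < x <= 1)%R -> (fr x)%:E = f x.
  by move=> x01; rewrite fineK// (calibrator_fin_num uU pf).
have itv01 (x : R) : (0 < x <= 1)%R -> x \in `[0%R, 1%R].
  by move=> /andP[x0 x1]; rewrite in_itv/= ltW.
have fr0 x : (0 < x <= 1)%R -> (0 <= fr x)%R.
  by move=> x01; rewrite -lee_fin frE// f0// itv01.
have fr_ni y z : (0 < y)%R -> (y <= z)%R -> (z <= 1)%R -> (fr z <= fr y)%R.
  move=> y0 yz z1.
  have y01 : (0 < y <= 1)%R by rewrite y0 (le_trans yz).
  have z01 : (0 < z <= 1)%R by rewrite z1 (lt_le_trans y0).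
  by rewrite -lee_fin !frE// f_ni ?itv01.
have cfr t y z : (0 <= t <= 1)%R -> (0 < y <= 1)%R -> (0 < z <= 1)%R ->
    (fr (t * y + (1 - t) * z) <= t * fr y + (1 - t) * fr z)%R.
  move=> t01 y01 z01.
  have yz01 : (0 < t * y + (1 - t) * z <= 1)%R by nra.
  rewrite -lee_fin EFinD !EFinM !frE//.
  by apply: cf; [exact: t01|exact: itv01|exact: itv01].
pose h n := lip_hull fr n.
have h0 n x : (0 <= h n x)%R by exact: lip_hull_ge0.
have h_ni n := lip_hull_nonincreasing n fr0.
have mh n : measurable_fun setT (h n) by exact: nonincreasing_measurable.
apply: (@integral_le_of_cvg _ _ _ P (fun n w => (h n (X w))%:E)) => //.
- by move=> n; apply/measurable_EFinP; exact: measurableT_comp.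
- by move=> n w; rewrite lee_fin.
- by move=> w; apply: f0; exact: clamp01_itv.
(* Off this null event the approximations are eventually equal to [f (clamp01 (X w))]. *)
- exists [set w | (X w <= 0)%R]; split; [exact: measurable_le0|exact: pstar_variable_gt0|].
  move=> w /= ncv; rewrite leNgt; apply/negP => Xw0; apply: ncv.
  have m01 : (0 < Num.min (X w) 1 <= 1)%R by rewrite lt_min Xw0 ltr01 ge_min lexx orbT.
  rewrite /clamp01 max_r; last by rewrite le_min ltW// ler01.
  have : \forall n \near \oo, (h n (X w))%:E = f (Num.min (X w) 1%R); last exact: cvg_near_cst.
  apply: filterS (lip_hull_eventually fr0 fr_ni cfr Xw0) => n hn.
  by rewrite /h hn frE.
(* The chain is E h_n(X) <= E h_n(V) = E h_n(U) <= E f(U) <= 1, the second inequality because [h n]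
   lies below [f]. *)
- move=> n; apply: (le_trans (st_le2_integral VX (h_ni n) (lip_hull_convex _ fr0 cfr) (h0 n))).
  rewrite (uniform01_integral_eq (h := EFin \o h n) uV uU)//=; last 2 first.
  + exact/measurable_EFinP.
  + by move=> x; rewrite lee_fin.
  apply: le_trans (calibrator_integral_le1 uU pf).
  apply: ge0_le_integral => //.
  + by move=> w _; rewrite lee_fin.
  + by apply/measurable_EFinP; exact: measurableT_comp.
  + exact: (measurableT_comp mF).
  + move=> w _; have /andP[Uw0 Uw1] := U01 w.
    have Uw01 : (0 < U w <= 1)%R by rewrite Uw0 ltW.
    by rewrite clamp01_id ?(ltW Uw0) ?(ltW Uw1)// -frE// lee_fin lip_hull_le_self.
Qed.

(** Every p-variable is a p*-variable, so a p*-to-e calibrator strictly dominating [f] would also be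
    a p-to-e calibrator doing so. *)
Lemma convex01_pstar_admissible f : rich P ->
  convex01 f -> admissible (p_to_e_calibrator P) f ->
  admissible (pstar_to_e_calibrator P) f.
Proof.
move=> hrich cf [pf maxf]; split; first exact: convex01_pstar_calibrator.
move=> [g [g0 g_ni Vg] gf]; apply: maxf; exists g => //.
by split => // X pX; apply: Vg; exact: pstar_variableW.
Qed.

(** * A criterion for p*-variables in the unit interval, and pooling *)

Lemma expectation_1_minus X (h : R -> R) : {homo h : x y / (x <= y)%R} ->
  measurable_fun setT X -> (forall w, (0 <= X w <= 1)%R) ->
  'E_P[h \o X] = (h 1%R)%:E - \int[P]_w (h 1%R - h (X w))%:E.
Proof.
move=> h_nd mX X01; rewrite unlock.
have mhX : measurable_fun setT (h \o X).
  by apply: measurableT_comp => //; exact: nondecreasing_measurable.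
have ihX : P.-integrable setT (EFin \o (h \o X)).
  apply: measurable_bounded_integrable => //.
    by rewrite (le_lt_trans (probability_le1 P measurableT))// ltry.
  exists (Num.max `|h 0%R| `|h 1%R|)%R; split => // M MX w _ /=.
  have /andP[X0 X1] := X01 w.
  rewrite (le_trans _ (ltW MX))// ler_norml lerNl !le_max.
  have h0 := h_nd _ _ X0; have h1 := h_nd _ _ X1.
  apply/andP; split; apply/orP.
    by left; rewrite -normrN (le_trans _ (ler_norm _))// lerN2.
  by right; rewrite (le_trans h1)// ler_norm.
have i1 : P.-integrable setT (EFin \o cst (h 1%R)) by exact: finite_measure_integrable_cst.
under [in RHS]eq_integral do rewrite EFinB.
rewrite integralB//= integral_cst//= probability_setT mule1 oppeB; last first.
  by rewrite fin_num_adde_defr.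
by rewrite addeA subee// add0e.
Qed.

(** The substitution [k = h 1 - h] turns the comparison of expectations into one between integrals
    of nonnegative functions, all finite because the variables stay in [[0, 1]]. *)
Lemma st_le2_of_itv U X : (forall w, 0 <= U w <= 1)%R ->
  measurable_fun setT X -> (forall w, 0 <= X w <= 1)%R ->
  (forall k : R -> R, convex_real k -> {homo k : x y / (x <= y)%R >-> (y <= x)%R} ->
     k 1%R = 0%R -> \int[P]_w (k (X w))%:E <= \int[P]_w (k (U w))%:E) ->
  st_le2 P U X.
Proof.
move=> U01 mX X01 Hk h h_nd ch _ _.
rewrite !expectation_1_minus//; apply: leeB => //.
apply: (Hk (fun x => h 1%R - h x)%R).
- move=> t x y t01; move/concave_funP : ch => /(_ t x y t01); lra.
- by move=> x y xy; rewrite lerD2l lerN2 h_nd.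
- by rewrite subrr.
Qed.

Lemma indic_preimage_itv X (x y : R) w :
  \1_(X @^-1` `]x, y]) w = (x < X w <= y)%R%:R :> R.
Proof.
rewrite indicE.
have -> // : (w \in X @^-1` `]x, y]%classic) = (x < X w <= y)%R.
by apply/idP/idP; rewrite inE/= in_itv.
Qed.

Lemma measurable_indic_itv U (c x y : R) :
  measurable_fun setT (fun w => (c * \1_(U @^-1` `]x, y]) w)%:E).
Proof.
apply/measurable_EFinP; apply: measurable_funM => //; apply: measurable_indic.
exact: measurable_funPTI.
Qed.

Lemma uniform01_integral_indic U (c x y : R) : uniform01 U -> (0 <= c)%R ->
  (0 <= x)%R -> (x <= y)%R -> (y <= 1)%R ->
  \int[P]_w (c * \1_(U @^-1` `]x, y]) w)%:E = (c * (y - x))%:E.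
Proof.
move=> uU c0 x0 xy y1; under eq_integral do rewrite EFinM.
have mA : measurable (U @^-1` `]x, y]) by exact: measurable_funPTI.
rewrite ge0_integralZl//.
- by rewrite integral_indic// setIT [X in _ * X](uniform01_itv uU x0 xy y1).
- by apply/measurable_EFinP; exact: measurable_indic.
Qed.

(* On {U in ]a, a + t e]} and {U in ]b, b + (1 - t) e]}, X replaces U by a
   constant no smaller than its conditional mean there. *)
Lemma pooled_pstar_variable U (a b m t e : R) : uniform01 U ->
  (forall w, 0 < U w < 1)%R ->
  (0 < a)%R -> (a + e <= b)%R -> (b + e <= 1)%R -> (0 < e)%R ->
  (0 <= t <= 1)%R -> (a + e <= m)%R -> (m <= b + e)%R ->
  (t * a + (1 - t) * b + e <= m)%R ->
  pstar_variable P (fun w => if (U w \in `]a, (a + t * e)%R]) ||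
    (U w \in `]b, (b + (1 - t) * e)%R]) then m else U w).
Proof.
move=> uU U01 a0 ab b1 e0 /andP[t0 t1] am mb tm.
set X := fun w => _.
have mA1 : measurable (U @^-1` `]a, (a + t * e)%R]) by exact: measurable_funPTI.
have mA2 : measurable (U @^-1` `]b, (b + (1 - t) * e)%R]) by exact: measurable_funPTI.
have mX : measurable_fun setT X.
  apply: measurable_fun_ifT => //.
  apply: measurable_or; apply: (measurable_fun_bool true); rewrite setTI.
    exact: mA1.
  exact: mA2.
have te : (t * e <= e)%R by nra.
have te0 : (0 <= t * e)%R by nra.
have te' : ((1 - t) * e <= e)%R by nra.
have te0' : (0 <= (1 - t) * e)%R by nra.
split => //; exists U; split => //; apply: st_le2_of_itv => //.
- by move=> w; have /andP[U0 U1] := U01 w; rewrite !ltW.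
- move=> w; rewrite /X; case: ifPn => _; first lra.
  by have /andP[U0 U1] := U01 w; rewrite !ltW.
move=> k ck k_ni k1.
have mk : measurable_fun setT k by exact: nonincreasing_measurable.
have k0 x : (x <= 1)%R -> (0 <= k x)%R by move=> x1; rewrite -k1 k_ni.
have [s' s'P] := convex_real_support m ck.
pose s := (- s')%R.
have s0 : (0 <= s)%R.
  have mm : (m <= m + 1)%R by lra.
  by have := s'P (m + 1)%R; have := k_ni _ _ mm; rewrite /s; lra.
have sP x : (k m <= k x + s * (x - m))%R by have := s'P x; rewrite /s; lra.
(* By the support line at [m], of slope [- s], replacing [U] by [m] lowers [k] by at least [c1] on
   the first event and raises it by at most [c2] on the second. *)
pose c1 := (s * (m - a - e))%R; pose c2 := (s * (b + e - m))%R.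
have c10 : (0 <= c1)%R by apply: mulr_ge0 => //; lra.
have c20 : (0 <= c2)%R by apply: mulr_ge0 => //; lra.
have X1 w : (X w <= 1)%R.
  by rewrite /X; case: ifPn => _; [lra|have /andP[_ /ltW] := U01 w].
have mkX : measurable_fun setT (fun w => (k (X w))%:E).
  by apply/measurable_EFinP; exact: measurableT_comp.
have mkU : measurable_fun setT (fun w => (k (U w))%:E).
  by apply/measurable_EFinP; exact: measurableT_comp.
have kX0 w : 0 <= (k (X w))%:E by rewrite lee_fin k0.
have kU0 w : 0 <= (k (U w))%:E by rewrite lee_fin k0//; have /andP[_ /ltW] := U01 w.
have i0 (c : R) (A : set T) w : (0 <= c)%R -> 0 <= (c * \1_A w)%:E.
  by move=> c0; rewrite lee_fin mulr_ge0.
have b0 : (0 <= b)%R by lra.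
have at1 : (a <= a + t * e)%R by lra.
have at2 : (a + t * e <= 1)%R by lra.
have bt1 : (b <= b + (1 - t) * e)%R by lra.
have bt2 : (b + (1 - t) * e <= 1)%R by lra.
have : \int[P]_w ((k (X w))%:E + (c1 * \1_(U @^-1` `]a, (a + t * e)%R]) w)%:E) <=
       \int[P]_w ((k (U w))%:E + (c2 * \1_(U @^-1` `]b, (b + (1 - t) * e)%R]) w)%:E).
  apply: ge0_le_integral => //.
  - by move=> w _; rewrite adde_ge0// i0.
  - by apply: emeasurable_funD => //; exact: measurable_indic_itv.
  - by apply: emeasurable_funD => //; exact: measurable_indic_itv.
  move=> w _; rewrite -!EFinD lee_fin !indic_preimage_itv /X.
  have := sP (U w).
  rewrite !in_itv/=.
  case: (boolP (a < U w <= _)%R) => [/andP[u1 u2]|_];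
    case: (boolP (b < U w <= _)%R) => [/andP[u3 u4]|_] /=;
    rewrite ?mulr1 ?mulr0 ?addr0 ?lexx// => sU; first lra.
  - have : (s * (U w - m) <= s * (a + e - m))%R by apply: ler_wpM2l => //; lra.
    rewrite /c1; lra.
  - have : (s * (U w - m) <= s * (b + e - m))%R by apply: ler_wpM2l => //; lra.
    rewrite /c2; lra.
rewrite !ge0_integralD//; try by [move=> w _; exact: i0|exact: measurable_indic_itv].
rewrite !uniform01_integral_indic ?(ltW a0)//.
rewrite (addrC a) addrK (addrC b) addrK.
(* Divided by [s * e], this is exactly the hypothesis [t * a + (1 - t) * b + e <= m]: the mean loss
   is covered by the mean gain. *)
have c21 : (c2 * ((1 - t) * e) <= c1 * (t * e))%R.
  rewrite /c1 /c2 -!mulrA ler_wpM2l// !mulrA ler_wpM2r ?(ltW e0)//; lra.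
move=> H; rewrite -(@leeD2rE _ (c1 * (t * e))%:E)//.
by rewrite (le_trans H)// leeD2l// lee_fin.
Qed.

(** * What admissibility forces on a calibrator *)

Lemma admissible_maximal U f g : uniform01 U ->
  admissible (p_to_e_calibrator P) f ->
  {in `[0%R, 1%R] &, forall x y, (x <= y)%R -> g y <= g x} ->
  (forall x : R, x \in `[0%R, 1%R] -> f x <= g x) ->
  \int[P]_w g (clamp01 (U w)) <= 1 ->
  forall x : R, x \in `[0%R, 1%R] -> f x = g x.
Proof.
move=> uU [pf maxf] g_ni fg gU x x01; apply: contrapT => fgx; apply: maxf.
exists g; last by split => //; exists x => // gfx; exact: fgx.
have [f0 _ _] := pf.
by apply: (p_to_e_calibratorP uU) => // y y01; rewrite (le_trans (f0 _ y01)) ?fg.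
Qed.

(** Raising the value at 0 to [+oo] leaves the mean unchanged, as [U] never takes the value 0. *)
Lemma admissible_at0 U f : uniform01 U -> (forall w, 0 < U w < 1)%R ->
  admissible (p_to_e_calibrator P) f -> f 0%R = +oo.
Proof.
move=> uU U01 af; have [pf _] := af; have [f0 f_ni _] := pf.
pose g x := if x == 0%R then +oo else f x.
rewrite (@admissible_maximal _ f g uU af) /g ?eqxx//.
- move=> x y x01 y01 xy; case: (eqVneq x 0%R) => [_|x0]; first exact: leey.
  case: (eqVneq y 0%R) => [y0|_]; last exact: f_ni.
  case/eqP: x0; apply/le_anti; rewrite -{1}y0 xy.
  by move: x01; rewrite in_itv => /andP[].
- by move=> x x01; case: ifPn => // _; exact: leey.
- under eq_integral.
    by move=> w _; have /andP[U0 U1] := U01 w; rewrite clamp01_id ?ltW// gt_eqF//; over.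
  apply: le_trans (calibrator_integral_le1 uU pf).
  rewrite le_eqVlt; apply/orP; left; apply/eqP; apply: eq_integral => w _.
  by have /andP[U0 U1] := U01 w; rewrite clamp01_id ?ltW.
- by rewrite in_itv/= lexx ler01.
Qed.

(** Left continuity at 1, phrased through lower bounds [l]: raising [f 1] to [l] keeps [f]
    decreasing and leaves the mean unchanged, as [U] never takes the value 1. *)
Lemma admissible_at1 U f (l : \bar R) : uniform01 U -> (forall w, 0 < U w < 1)%R ->
  admissible (p_to_e_calibrator P) f ->
  (forall x : R, (0 < x < 1)%R -> l <= f x) -> l <= f 1%R.
Proof.
move=> uU U01 af lf; have [pf _] := af; have [f0 f_ni _] := pf.
pose g x := if x == 1%R then maxe (f 1%R) l else f x.
rewrite (@admissible_maximal _ f g uU af) /g ?eqxx ?le_max ?lexx ?orbT//.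
- move=> x y x01 y01 xy.
  case: (eqVneq y 1%R) => [y1|y1]; case: (eqVneq x 1%R) => [x1|x1] //.
  + have xlt1 : (x < 1)%R by rewrite lt_neqAle x1 -y1.
    (* [l] bounds [f] only on the open interval, and [x] may be 0. *)
    have x'1 : (0 < Num.max x (1 / 2) < 1)%R.
      by rewrite lt_max gt_max xlt1; apply/andP; split; [apply/orP; right|]; lra.
    rewrite ge_max -{1}y1 f_ni//=; apply: (le_trans (lf _ x'1)); apply: f_ni => //.
      by rewrite in_itv/=; case/andP: x'1 => ? ?; rewrite !ltW.
    by rewrite le_max lexx.
  + case/eqP: y1; apply/le_anti; rewrite -{2}x1 xy andbT.
    by move: y01; rewrite in_itv => /andP[].
  + exact: f_ni.
- by move=> x x01; case: ifPn => // /eqP ->; rewrite le_max lexx.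
- apply: le_trans (calibrator_integral_le1 uU pf).
  rewrite le_eqVlt; apply/orP; left; apply/eqP; apply: eq_integral => w _.
  by have /andP[U0 U1] := U01 w; rewrite clamp01_id ?ltW// lt_eqF.
- by rewrite in_itv/= lexx ler01.
Qed.

(** Otherwise the missing mass could be added to [f] as a constant. Maximality then gives equality
    at 1, where [f] is finite, so this constant is 0. *)
Lemma admissible_integral U f : uniform01 U ->
  admissible (p_to_e_calibrator P) f -> \int[P]_w f (clamp01 (U w)) = 1.
Proof.
move=> uU af; have [pf _] := af; have [f0 f_ni _] := pf.
have := calibrator_integral_le1 uU pf.
set s := \int[P]_w _ => s1.
have s0 : 0 <= s by apply: integral_ge0 => w _; apply: f0; exact: clamp01_itv.
have sE : s = (fine s)%:E.
  by rewrite fineK// ge0_fin_numE// (le_lt_trans s1)// ltry.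
have c0 : (0 <= 1 - fine s)%R by move: s1; rewrite sE lee_fin; lra.
pose g x := f x + (1 - fine s)%:E.
have mf : measurable_fun setT (fun w => f (clamp01 (U w))).
  apply: (measurableT_comp (nonincreasing_emeasurable (clamp01_comp_nonincreasing f_ni))).
  exact: measurable_funP.
have i1 : 1%R \in `[0%R, 1%R :> R] by rewrite in_itv/= lexx ler01.
have : f 1%R = g 1%R.
  apply: (@admissible_maximal _ f g uU af) => //.
  - by move=> x y x01 y01 xy; rewrite leeD2r// f_ni.
  - by move=> x x01; rewrite leeDl// lee_fin.
  rewrite ge0_integralD//.
  - by rewrite integral_cst//= probability_setT mule1 -/s sE -EFinD lee_fin; lra.
  - by move=> w _; apply: f0; exact: clamp01_itv.
have f1 : f 1%R \is a fin_num by apply: (calibrator_fin_num uU pf); rewrite ltr01 lexx.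
rewrite /g -(fineK f1) -EFinD => -[]; rewrite sE => h; congr EFin; lra.
Qed.

Lemma pooling_inequality U f (a b t t' : R) : uniform01 U ->
  (forall w, 0 < U w < 1)%R ->
  admissible (p_to_e_calibrator P) f -> pstar_to_e_calibrator P f ->
  (0 < a)%R -> (a < b)%R -> (b < 1)%R -> (0 <= t)%R -> (t < t')%R -> (t' <= 1)%R ->
  f (t * a + (1 - t) * b)%R <= t'%:E * f a + (1 - t')%:E * f b.
Proof.
move=> uU U01 af sf a0 ab b1 t0 tt' t'1.
have [pf _] := af; have [f0 f_ni _] := pf.
set m := (t * a + (1 - t) * b)%R.
(* [(t' - t) * (b - a)] is the gap between [m] and the mean of [a] and [b] with weights [t'] and
   [1 - t'], hence the slack available for pooling; [1 - b] keeps the second interval inside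
   [[0, 1]]. *)
pose e := Num.min ((t' - t) * (b - a))%R (1 - b)%R.
have e1 : (e <= (t' - t) * (b - a))%R by rewrite ge_min lexx.
have e2 : (e <= 1 - b)%R by rewrite ge_min lexx orbT.
have e0 : (0 < e)%R by rewrite lt_min; apply/andP; split; nra.
have m0 : (a <= m)%R by rewrite /m; nra.
have m1 : (m <= b)%R by rewrite /m; nra.
have h1 : (a + e <= b)%R by nra.
have h2 : (b + e <= 1)%R by lra.
have h3 : (0 <= t' <= 1)%R by lra.
have h4 : (a + e <= m)%R by rewrite /m; nra.
have h5 : (m <= b + e)%R by lra.
have h6 : (t' * a + (1 - t') * b + e <= m)%R by rewrite /m; lra.
have := pooled_pstar_variable uU U01 a0 h1 h2 e0 h3 h4 h5 h6.
set X := fun w => _ => /(let: And3 _ _ H := sf in H _) [mfX fX0 fX1].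
have fin x : (0 < x)%R -> (x <= 1)%R -> f x \is a fin_num.
  by move=> x0 x1; apply: (calibrator_fin_num uU pf); rewrite x0.
have b0 : (0 < b)%R by lra.
have mp : (0 < m)%R by lra.
have ml1 : (m <= 1)%R by lra.
have fa : f a \is a fin_num by apply: fin => //; lra.
have fb : f b \is a fin_num by apply: fin => //; lra.
have fm : f m \is a fin_num by apply: fin.
have i01 (x : R) : (0 < x)%R -> (x <= 1)%R -> x \in `[0%R, 1%R].
  by move=> x0 x1; rewrite in_itv/= ltW.
have fr0 (x : R) : (0 < x)%R -> (x <= 1)%R -> (0 <= fine (f x))%R.
  by move=> x0 x1; rewrite fine_ge0// f0 ?i01.
have p1 := fr0 _ a0 ltac:(lra); have p2 := fr0 _ b0 (ltW b1); have p3 := fr0 _ mp ml1.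
have i0 (c x y : R) w : (0 <= c)%R -> 0 <= (c * \1_(U @^-1` `]x, y]) w)%:E.
  by move=> c0; rewrite lee_fin mulr_ge0.
have te0 : (0 <= t' * e)%R by nra.
have te0' : (0 <= (1 - t') * e)%R by nra.
have te : (t' * e <= e)%R by nra.
have te' : ((1 - t') * e <= e)%R by nra.
have at1 : (a <= a + t' * e)%R by lra.
have at2 : (a + t' * e <= 1)%R by lra.
have bt1 : (b <= b + (1 - t') * e)%R by lra.
have bt2 : (b + (1 - t') * e <= 1)%R by lra.
have mU : measurable_fun setT (fun w => f (clamp01 (U w))).
  apply: (measurableT_comp (nonincreasing_emeasurable (clamp01_comp_nonincreasing f_ni))).
  exact: measurable_funP.
have fU0 w : 0 <= f (clamp01 (U w)) by apply: f0; exact: clamp01_itv.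
pose J (c x y : R) w := (c * \1_(U @^-1` `]x, y]) w)%:E.
have mJ c x y : measurable_fun setT (J c x y) by exact: measurable_indic_itv.
(* On the pooled events [f (U w)] is at most [f a], respectively [f b], and [X] carries [f m]. Since
   E f(X) <= 1 = E f(U), cancelling leaves the claim multiplied by [e]. *)
have : \int[P]_w (f (clamp01 (U w)) +
    (J (fine (f m)) a (a + t' * e)%R w + J (fine (f m)) b (b + (1 - t') * e)%R w)) <=
  \int[P]_w (f (clamp01 (X w)) +
    (J (fine (f a)) a (a + t' * e)%R w + J (fine (f b)) b (b + (1 - t') * e)%R w)).
  apply: ge0_le_integral => //.
  - by move=> w _; rewrite !adde_ge0 ?i0.
  - by do 2 (apply: emeasurable_funD => //).
  - by do 2 (apply: emeasurable_funD => //).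
  move=> w _; rewrite /J !indic_preimage_itv /X !in_itv/=.
  have /andP[U0 U1] := U01 w.
  have cU : clamp01 (U w) = U w by rewrite clamp01_id// !ltW.
  have cm : clamp01 m = m by rewrite clamp01_id// ml1 ltW.
  case: (boolP (a < U w <= _)%R) => [/andP[u1 u2]|_];
    case: (boolP (b < U w <= _)%R) => [/andP[u3 u4]|_] /=;
    rewrite ?mulr1 ?mulr0 ?addr0 ?add0r ?adde0 ?add0e ?cU ?cm ?lexx ?fineK//; first by exfalso; lra.
  - by rewrite addeC leeD2l// f_ni ?i01 ?ltW//; lra.
  - by rewrite addeC leeD2l// f_ni ?i01 ?ltW//; lra.
rewrite !ge0_integralD//; try by [move=> w _; rewrite ?adde_ge0 ?i0|apply: emeasurable_funD].
rewrite /J !(uniform01_integral_indic uU)// ?(ltW a0) ?(ltW b0)//.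
rewrite (admissible_integral uU af) -!EFinD => H.
have : (1 + (fine (f m) * (a + t' * e - a) + fine (f m) * (b + (1 - t') * e - b))%R)%:E <=
  (1 + (fine (f a) * (a + t' * e - a) + fine (f b) * (b + (1 - t') * e - b))%R)%:E.
  by rewrite EFinD (le_trans H)// [leRHS]EFinD leeD2r.
rewrite lee_fin -[f m]fineK// -[f a]fineK// -[f b]fineK// -!EFinM -EFinD lee_fin => K.
rewrite -(ler_pM2r e0); lra.
Qed.

Lemma admissible_pstar_convex f : rich P ->
  admissible (p_to_e_calibrator P) f -> pstar_to_e_calibrator P f -> convex01 f.
Proof.
move=> hrich af sf; have [U uU U01] := uniform01_exists hrich.
have [pf _] := af; have [f0 f_ni _] := pf.
have fin x : (0 < x <= 1)%R -> f x \is a fin_num := calibrator_fin_num uU pf.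
have i01 (x : R) : (0 < x)%R -> (x <= 1)%R -> x \in `[0%R, 1%R].
  by move=> x0 x1; rewrite in_itv/= ltW.
have H1 (a b t : R) : (0 < a)%R -> (a < b)%R -> (b < 1)%R -> (0 < t < 1)%R ->
    f (t * a + (1 - t) * b)%R <= t%:E * f a + (1 - t)%:E * f b.
  move=> a0 ab b1 /andP[t0 t1].
  have fa : f a \is a fin_num by apply: fin; lra.
  have fb : f b \is a fin_num by apply: fin; lra.
  have fm : f (t * a + (1 - t) * b)%R \is a fin_num by apply: fin; apply/andP; split; nra.
  rewrite -[f (_ + _)%R]fineK// -[f a]fineK// -[f b]fineK// -!EFinM -EFinD lee_fin.
  apply/ler_addgt0Pr => e e0.
  (* Moving the weight from [t] to [t'] changes the right side by at most [(t' - t) * D <= e]; the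
     summand 1 makes [D] positive. *)
  pose D := (1 + `|fine (f a)| + `|fine (f b)|)%R.
  have n1 := normr_ge0 (fine (f a)); have n2 := normr_ge0 (fine (f b)).
  have n3 := ler_norm (fine (f a)); have n4 := ler_norm (- fine (f b))%R.
  rewrite normrN in n4.
  have D0 : (0 < D)%R by rewrite /D; lra.
  pose t' := (t + Num.min (1 - t)%R (e / D)%R)%R.
  have q1 : (Num.min (1 - t) (e / D) <= 1 - t)%R by rewrite ge_min lexx.
  have q2 : (Num.min (1 - t) (e / D) <= e / D)%R by rewrite ge_min lexx orbT.
  have q0 : (0 < Num.min (1 - t) (e / D))%R by rewrite lt_min divr_gt0// andbT; lra.
  have h1 : (t < t')%R by rewrite /t'; lra.
  have h2 : (t' <= 1)%R by rewrite /t'; lra.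
  have := pooling_inequality uU U01 af sf a0 ab b1 (ltW t0) h1 h2.
  rewrite -[f (_ + _)%R]fineK// -[f a]fineK// -[f b]fineK// -!EFinM -EFinD lee_fin.
  rewrite ler_pdivlMr// in q2; rewrite /t' /D in q2 *.
  set q := Num.min _ _ in q0 q2 *; nra.
have H2 (a b t : R) : (0 < a)%R -> (a <= b)%R -> (b <= 1)%R -> (0 < t < 1)%R ->
    f (t * a + (1 - t) * b)%R <= t%:E * f a + (1 - t)%:E * f b.
  move=> a0 + b1 t01; rewrite le_eqVlt => /predU1P[->|ab].
    have t1 : (0 <= 1 - t)%R by lra.
    have t0 : (0 <= t)%R by lra.
    rewrite -ge0_muleDl ?lee_fin// -EFinD (_ : t + (1 - t) = 1)%R ?mul1e; last lra.
    by rewrite (_ : t * b + (1 - t) * b = b)%R //; lra.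
  move: b1; rewrite le_eqVlt => /predU1P[b1|b1]; last exact: H1.
  have fa : f a \is a fin_num by apply: fin; lra.
  have fb : f b \is a fin_num by apply: fin; lra.
  have mm : (0 < t * a + (1 - t) * b <= 1)%R by nra.
  have fm : f (t * a + (1 - t) * b)%R \is a fin_num by apply: fin.
  rewrite -[f (_ + _)%R]fineK// -[f a]fineK// -[f b]fineK// -!EFinM -EFinD lee_fin.
  have t1 : (0 < 1 - t)%R by lra.
  (* For [b = 1] the inequality is solved for [f b]: this quotient bounds [f] from below on []0,
     1[], hence also at 1. *)
  have : ((fine (f (t * a + (1 - t) * b)) - t * fine (f a)) / (1 - t))%:E <= f 1%R.
    apply: (admissible_at1 uU U01 af) => x x01.
    (* [x] is pushed strictly to the right of [a], which can only decrease [f], so that [H1]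
       applies. *)
    pose x' := Num.max x ((a + 1) / 2)%R.
    have xx' : (x <= x')%R by rewrite le_max lexx.
    have ax' : (a < x')%R by rewrite lt_max; apply/orP; right; lra.
    have x'1 : (x' < 1)%R by rewrite gt_max; apply/andP; split; lra.
    have fx' : f x' \is a fin_num by apply: fin; lra.
    apply: (@le_trans _ _ (f x')); last by apply: f_ni => //; apply: i01; lra.
    have mm' : (0 < t * a + (1 - t) * x' <= 1)%R by nra.
    have : f (t * a + (1 - t) * b)%R <= t%:E * f a + (1 - t)%:E * f x'.
      apply: le_trans (H1 _ _ _ a0 ax' x'1 t01).
      by apply: f_ni; [apply: i01; lra|apply: i01; lra|nra].
    rewrite -[f (_ + _)%R]fineK// -[f a]fineK// -[f x']fineK// -!EFinM -EFinD !lee_fin.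
    by rewrite ler_pdivrMr//; lra.
  rewrite -b1 -[f b]fineK// lee_fin ler_pdivrMr//; lra.
(* If an endpoint is 0, then [f 0 = +oo] with a positive weight makes the right side infinite. *)
have infy (c : R) (z : \bar R) : (0 < c)%R -> 0 <= z -> c%:E * +oo + z = +oo.
  by move=> c0 z0; rewrite gt0_muley ?lte_fin// addye// (gt_eqF (lt_le_trans _ z0)).
move=> t x y; rewrite !in_itv/= => /andP[t0 t1] /andP[x0 x1] /andP[y0 y1].
have [->|tn0] := eqVneq t 0%R; first by rewrite mul0r add0r subr0 !mul1r mul0e mul1e add0e.
have [->|tn1] := eqVneq t 1%R; first by rewrite subrr mul0r addr0 !mul1r mul0e mul1e adde0.
have tp : (0 < t)%R by rewrite lt_neqAle eq_sym tn0.
have tlt1 : (t < 1)%R by rewrite lt_neqAle tn1.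
have t'0 : (0 <= 1 - t)%R by lra.
have t'p : (0 < 1 - t)%R by lra.
have [->|xn0] := eqVneq x 0%R.
  by rewrite (admissible_at0 uU U01 af) infy ?leey// mule_ge0 ?lee_fin// f0// in_itv/= y0.
have [->|yn0] := eqVneq y 0%R.
  by rewrite addeC (admissible_at0 uU U01 af) infy ?leey// mule_ge0 ?lee_fin// f0// in_itv/= x0.
have xp : (0 < x)%R by rewrite lt_neqAle eq_sym xn0.
have yp : (0 < y)%R by rewrite lt_neqAle eq_sym yn0.
have [xy|yx] := leP x y; first by apply: H2 => //; lra.
have := H2 y x (1 - t)%R yp (ltW yx) x1 ltac:(lra).
by rewrite (_ : 1 - (1 - t) = t)%R 1?addeC 1?[X in f X]addrC//; lra.
Qed.

(** * The calibrator [half_inv] and its optimality *)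

Lemma half_inv_y : half_inv (+oo : \bar R) = 0%R.
Proof. by rewrite /half_inv gt0_muley ?lte_fin// invey min_l. Qed.

Lemma half_inv_fin (r : R) : (0 <= r)%R ->
  half_inv r%:E = if (r <= 1 / 2)%R then 1%R else (2 * r)^-1%R.
Proof.
move=> r0; rewrite /half_inv -EFinM inver mulf_eq0 (_ : 2%R == 0%R :> R = false)//=; last first.
  by rewrite pnatr_eq0.
have [->|rn0] := eqVneq r 0%R; first by rewrite minye /= ifT//; lra.
have rp : (0 < r)%R by rewrite lt_neqAle eq_sym rn0.
have r2 : (0 < 2 * r)%R by lra.
rewrite -EFin_min/=; case: ifPn => h.
  by rewrite min_r// -[leLHS]invr1 lef_pV2 ?posrE//; lra.
by rewrite min_l// -[leRHS]invr1 lef_pV2 ?posrE//; lra.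
Qed.

Lemma half_inv_itv (e : \bar R) : 0 <= e -> half_inv e \in `[0%R, 1%R].
Proof.
case: e => [r| |]// r0; last by rewrite half_inv_y in_itv/= lexx ler01.
rewrite half_inv_fin//; case: ifPn => h; rewrite in_itv/= ?ler01 ?lexx//.
rewrite lee_fin in r0; rewrite invr_ge0 mulr_ge0//= invf_le1; lra.
Qed.

Lemma half_inv_nonincreasing (e1 e2 : \bar R) : 0 <= e1 -> e1 <= e2 ->
  (half_inv e2 <= half_inv e1)%R.
Proof.
move=> e10 e12; have := half_inv_itv e10; rewrite in_itv/= => /andP[i0 i1].
have := half_inv_itv (le_trans e10 e12); rewrite in_itv/= => /andP[j0 j1].
move: e10 e12 i0 i1 j0 j1; case: e1 => [r| |]//; case: e2 => [s| |]//; rewrite ?half_inv_y//.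
rewrite !lee_fin => r0 rs; rewrite !half_inv_fin//; last exact: le_trans rs.
do 2 case: ifPn => // ?; move=> _ _ _ _; first lra.
by rewrite lef_pV2 ?posrE; lra.
Qed.

Lemma measurable_half_inv (E : T -> \bar R) : measurable_fun setT E ->
  (forall w, 0 <= E w) -> measurable_fun setT (@half_inv R \o E).
Proof.
move=> mE E0.
(* Extending [half_inv] constantly to negative reals makes it monotone on the whole line, hence
   measurable; the value [+oo] of [E] is split off. *)
pose hr (x : R) := half_inv (Num.max x 0%R)%:E.
have mhr : measurable_fun setT hr.
  apply: nonincreasing_measurable => // x y xy; apply: half_inv_nonincreasing.
    by rewrite lee_fin le_max lexx orbT.
  by rewrite lee_fin; apply: le_max2.
apply: (eq_measurable_fun (fun w => if E w == +oo then 0%R else hr (fine (E w)))).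
  move=> w _ /=; case: ifPn => [/eqP->|Ey]; first by rewrite half_inv_y.
  by rewrite /hr max_l ?fine_ge0// fineK// ge0_fin_numE// ltey.
apply: measurable_fun_ifT => //.
- apply: (measurable_fun_bool true); rewrite setTI.
  rewrite (_ : _ @^-1` _ = E @^-1` [set +oo]); last first.
    by apply/seteqP; split => w /= /eqP.
  by rewrite -[X in measurable X]setTI; exact: mE.
- by apply: measurableT_comp => //; exact: measurableT_comp.
Qed.

(* With s the slope of a support line of k at x and u0 its zero, the line lies
   below k, and the triangle it bounds has area s u0^2 / 2 >= 2 x s (u0 - x) =
   2 x k(x) by AM-GM. *)
Lemma convex_mean_ge U (k : R -> R) (x : R) : uniform01 U ->
  (forall w, 0 < U w < 1)%R -> convex_real k ->
  {homo k : x y / (x <= y)%R >-> (y <= x)%R} -> k 1%R = 0%R ->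
  (0 < x)%R -> (x <= 1)%R -> (2 * x * k x)%:E <= \int[P]_w (k (U w))%:E.
Proof.
move=> uU U01 ck k_ni k1 x0 x1.
have k0 y : (y <= 1)%R -> (0 <= k y)%R by move=> y1; rewrite -k1 k_ni.
have kU0 w : (0 <= k (U w))%R by apply: k0; have /andP[_ /ltW] := U01 w.
have [kx|kx] := leP (k x) 0%R.
  apply: (@le_trans _ _ 0); first by rewrite lee_fin; nra.
  by apply: integral_ge0 => w _; rewrite lee_fin.
have [s' s'P] := convex_real_support x ck.
have xlt1 : (x < 1)%R by rewrite lt_neqAle x1 andbT; apply/eqP => x1'; move: kx; rewrite x1' k1 ltxx.
pose s := (- s')%R.
have s0 : (0 < s)%R.
  have := s'P 1%R; rewrite k1 /s => h.
  by rewrite ltNge; apply/negP => h'; nra.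
have sP u : (k x - s * (u - x) <= k u)%R by have := s'P u; rewrite /s; lra.
have sn0 : s != 0%R by rewrite gt_eqF.
pose u0 := (x + k x / s)%R.
have u0E : (s * (u0 - x) = k x)%R by rewrite /u0; field.
have u0p : (0 < u0)%R by rewrite /u0 addr_gt0// divr_gt0.
(* At 1 the support line is at most [k 1 = 0], so its zero comes no later and the whole triangle
   lies over the range of [U]. *)
have u01 : (u0 <= 1)%R.
  have := sP 1%R; rewrite k1 -u0E => h; rewrite -(ler_pM2l s0); lra.
have mk : measurable_fun setT k by exact: nonincreasing_measurable.
have mM : measurable_fun setT (fun w => (Num.max (u0 - U w) 0)%:E).
  apply/measurable_EFinP; apply: measurable_maxr => //; exact: measurable_funB.
apply: (@le_trans _ _ (\int[P]_w (s%:E * (Num.max (u0 - U w) 0)%:E))).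
  rewrite ge0_integralZl//; last 2 first.
  - by move=> w _; rewrite lee_fin le_max lexx orbT.
  - by rewrite lee_fin ltW.
  rewrite uniform01_excess// -EFinM lee_fin -u0E.
  have : (0 <= s * (u0 - 2 * x) ^+ 2)%R by rewrite mulr_ge0 ?sqr_ge0// ltW.
  by lra.
apply: ge0_le_integral => //.
- by move=> w _; rewrite -EFinM lee_fin mulr_ge0 ?(ltW s0)// le_max lexx orbT.
- by apply: measurable_funeM.
- by apply/measurable_EFinP; exact: measurableT_comp.
move=> w _; rewrite -EFinM lee_fin maxr_pMr ?(ltW s0)// mulr0 ge_max kU0 andbT.
by have := sP (U w); rewrite -u0E; lra.
Qed.

Lemma half_inv_calibrator : rich P -> e_to_pstar_calibrator P (@half_inv R).
Proof.
move=> hrich; split; [exact: half_inv_itv|exact: half_inv_nonincreasing|].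
move=> E [mE E0 E1].
have [U uU U01] := uniform01_exists hrich.
have mX := measurable_half_inv mE E0.
split => //; exists U; split => //; apply: st_le2_of_itv => //.
- by move=> w; have /andP[U0 U1] := U01 w; rewrite !ltW.
- by move=> w; have := half_inv_itv (E0 w); rewrite in_itv.
move=> k ck k_ni k1.
have k0 y : (y <= 1)%R -> (0 <= k y)%R by move=> y1; rewrite -k1 k_ni.
have mk : measurable_fun setT k by exact: nonincreasing_measurable.
have [U0 U1] : (forall w, 0 <= U w)%R /\ (forall w, U w <= 1)%R.
  by split => w; have /andP[/ltW u0 /ltW u1] := U01 w.
have mkU : measurable_fun setT (fun w => (k (U w))%:E).
  by apply/measurable_EFinP; exact: measurableT_comp.
have kU0 : 0 <= \int[P]_w (k (U w))%:E.
  by apply: integral_ge0 => w _; rewrite lee_fin k0.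
have kUfin : \int[P]_w (k (U w))%:E \is a fin_num.
  rewrite ge0_fin_numE//; apply: (@le_lt_trans _ _ (k 0%R)%:E); last exact: ltry.
  rewrite -[leRHS]mule1 -(probability_setT P) -integral_cst//.
  apply: ge0_le_integral => //; first by move=> w _; rewrite lee_fin k0.
  by move=> w _; rewrite lee_fin k_ni.
set B := \int[P]_w (k (U w))%:E in kU0 kUfin *.
(* The pointwise bound is [k (half_inv (E w)) <= B * E w], and integrating it uses that [E] has mean
   at most 1. *)
apply: (@le_trans _ _ (\int[P]_w (B * E w))); last first.
  rewrite ge0_integralZl//.
  by rewrite -[leRHS]mule1 lee_wpmul2l.
have iE : P.-integrable setT E.
  apply/integrableP; split => //.
  under eq_integral do rewrite gee0_abs//.
  by rewrite (le_lt_trans E1)// ltry.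
apply: ae_ge0_le_integral => //.
- move=> w _; rewrite lee_fin k0//.
  by have := half_inv_itv (E0 w); rewrite in_itv/= => /andP[].
- by apply/measurable_EFinP; exact: measurableT_comp.
- by move=> w _; rewrite mule_ge0.
- exact: measurable_funeM.
(* Integrability makes [E] finite almost everywhere. A value [r <= 1 / 2] is sent to 1, where [k]
   vanishes; for larger [r], [convex_mean_ge] at [(2 * r)^-1] reads [k ((2 * r)^-1) / r <= B]. *)
apply: filterS (integrable_ae measurableT iE) => w /(_ I) Efin _ /=.
have := E0 w; rewrite -(fineK Efin); set r := fine _; rewrite lee_fin => r0.
rewrite half_inv_fin//; case: ifPn => h; first by rewrite k1 mule_ge0.
have r2 : (1 < 2 * r)%R by lra.
have x0 : (0 < (2 * r)^-1)%R by rewrite invr_gt0; lra.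
have x1 : ((2 * r)^-1 <= 1)%R by rewrite invf_le1; lra.
have := convex_mean_ge uU U01 ck k_ni k1 x0 x1; rewrite -/B -(fineK kUfin) -!EFinM !lee_fin.
move: (k _) (fine B) => K b H.
have rn0 : r != 0%R by rewrite gt_eqF//; lra.
have := ler_wpM2r r0 H.
by rewrite (_ : 2 / (2 * r) * K * r = K)%R//; field.
Qed.

Lemma calibrator_ge_half_inv (g : \bar R -> R) (r : R) : rich P ->
  e_to_pstar_calibrator P g -> (1 <= r)%R -> ((2 * r)^-1 <= g r%:E)%R.
Proof.
move=> hrich [g01 g_ni gE] r1; have [U uU U01] := uniform01_exists hrich.
have r0 : (0 < r)%R by lra.
have a0 : (0 < r^-1)%R by rewrite invr_gt0.
have a1 : (r^-1 <= 1)%R by rewrite invf_le1.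
pose E w : \bar R := (r * \1_(U @^-1` `]0%R, r^-1]) w)%:E.
have eE : e_variable P E.
  split; first exact: measurable_indic_itv.
    by move=> w; rewrite lee_fin mulr_ge0// ltW.
  by rewrite uniform01_integral_indic ?(ltW r0) ?(ltW a0)// subr0 divff ?gt_eqF.
have pX := gE _ eE; have [mX _] := pX.
(* [c] is the value of the test function [(r^-1 - x)^+] at [g (E w)] on the event where [E w = r],
   which has probability [r^-1]. *)
pose c := Num.max (r^-1 - g r%:E)%R 0%R.
have c0 : (0 <= c)%R by rewrite le_max lexx orbT.
have : (c * (r^-1 - 0))%:E <= (r^-1 ^+ 2 / 2)%:E.
  rewrite -(uniform01_integral_indic uU c0 (lexx _) (ltW a0) a1).
  apply: le_trans (pstar_variable_excess pX a0 a1).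
  apply: ge0_le_integral => //.
  - by move=> w _; rewrite lee_fin mulr_ge0.
  - exact: measurable_indic_itv.
  - apply/measurable_EFinP; apply: measurable_maxr => //; exact: measurable_funB.
  move=> w _; rewrite lee_fin /E/= indic_preimage_itv.
  case: (boolP (_ < _ <= _)%R) => h /=; last by rewrite mulr0 le_max lexx orbT.
  by rewrite !mulr1.
rewrite lee_fin subr0 => H.
have cr : (c <= r^-1 / 2)%R by rewrite -(ler_pM2r a0); move: H; lra.
have : (r^-1 - g r%:E <= c)%R by rewrite le_max lexx.
have -> : ((2 * r)^-1 = r^-1 / 2)%R by field; rewrite gt_eqF.
lra.
Qed.

Lemma half_inv_essentially_dominates (g : \bar R -> R) : rich P ->
  e_to_pstar_calibrator P g -> essentially_dominates (@half_inv R) g.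
Proof.
move=> hrich cg; have [g01 g_ni _] := cg.
case=> [r| |]// r0 gr; last first.
  by rewrite half_inv_y; have := g01 +oo r0; rewrite in_itv => /andP[].
rewrite lee_fin in r0.
(* For [r < 1] monotonicity gives [g r >= g 1 >= 1 / 2], against the assumption [g r < 1 / 2]. *)
have r1 : (1 <= r)%R.
  rewrite leNgt; apply/negP => r1.
  have := calibrator_ge_half_inv hrich cg (lexx 1%R).
  have := g_ni r%:E 1%:E; rewrite !lee_fin => /(_ r0 (ltW r1)).
  by rewrite mulr1; lra.
rewrite half_inv_fin// ifF; first exact: calibrator_ge_half_inv.
by apply/negbTE; rewrite -ltNge; lra.
Qed.

End calibrators.

Theorem theorem6p2 (d : measure_display) (T : measurableType d) (R : realType)
    (P : probability T R) (hatomless : atomless P) (hrich : rich P) :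
  [/\ (forall f : R -> \bar R,
         convex01 f -> p_to_e_calibrator P f -> pstar_to_e_calibrator P f)
      /\
      (forall f : R -> \bar R,
         convex01 f -> admissible (p_to_e_calibrator P) f ->
         admissible (pstar_to_e_calibrator P) f),
      forall f : R -> \bar R,
        admissible (p_to_e_calibrator P) f ->
        (pstar_to_e_calibrator P f <-> convex01 f)
    & e_to_pstar_calibrator P (@half_inv R)
      /\
      forall g : \bar R -> R,
        e_to_pstar_calibrator P g ->
        essentially_dominates (@half_inv R) g].
Proof.
split.
- by split => f; [exact: convex01_pstar_calibrator|exact: convex01_pstar_admissible].
- move=> f af; split; first exact: admissible_pstar_convex.
  by move=> cf; apply: convex01_pstar_calibrator => //; case: af.
- split; first exact: half_inv_calibrator.
  by move=> g; exact: half_inv_essentially_dominates.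
Qed.
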